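(* Let $0<q<1$ and $A>0$. For real $\alpha>0$ and $\beta>\alpha+1$ one has $$\int_0^{\infty/A}\frac{x^\alpha}{(1+x)_q^\beta}\,d_qx=\frac{q}{q^\beta K(A;\alpha)}\int_1^{\infty/1}\frac{x^\alpha\big(1-\frac1x\big)_q^\alpha}{x^\beta}\,d_qx.$$
   Context: Fix $0<q<1$. Notation: $(1+a)_q^\infty=\prod_{j=0}^\infty(1+q^ja)$ and, for $t\in\mathbb C$, $(1+a)_q^t=\dfrac{(1+a)_q^\infty}{(1+q^ta)_q^\infty}$. Improper Jackson integral: for $C>0$, $\int_0^{\infty/C}f(x)\,d_qx=(1-q)\sum_{n\in\mathbb Z}\frac{q^n}{C}f\big(\frac{q^n}{C}\big)$. Also $\int_0^1f(x)\,d_qx=(1-q)\sum_{n\ge0}q^nf(q^n)$, and $\int_1^{\infty/1}f(x)\,d_qx=\int_0^{\infty/1}f(x)\,d_qx-\int_0^1f(x)\,d_qx$, i.e. $\int_1^{\infty/1}f(x)\,d_qx=(1-q)\sum_{n\le-1}q^nf(q^n)$. For $x>0$ and $t\in\mathbb R$, $K(x;t)=\dfrac{x^t}{1+x}\Big(1+\dfrac1x\Big)_q^t(1+x)_q^{1-t}$. *)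

(* Defs.v *)
(* Stdlib reals with Coquelicot. *)
From Stdlib Require Export Reals ZArith Lra.
From Coquelicot Require Export Coquelicot.
Open Scope R_scope.

(* (1 + a)_q^oo; [prod_f_R0 f N] is f 0 * ... * f N.  The limit exists and is
   finite whenever 0 < q < 1. *)
Definition qprod_inf (q a : R) : R :=
  real (Lim_seq (fun N => prod_f_R0 (fun j => 1 + q ^ j * a) N)).

(* (1 + a)_q^t.  The second argument is [a], not [1 + a]. *)
Definition qprod (q a t : R) : R :=
  qprod_inf q a / qprod_inf q (Rpower q t * a).

(* Real powers are [Rpower x t], which is x^t for x > 0; every base below is
   positive. *)
Definition K (q x t : R) : R :=
  Rpower x t / (1 + x) * qprod q (1 / x) t * qprod q x (1 - t).

(* A sum over all integers n converges when its parts over n >= 0 and over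
   n <= -1 both converge; [k : nat] below indexes n = - (k + 1). *)
Definition ex_zseries (u : Z -> R) : Prop :=
  ex_series (fun n : nat => u (Z.of_nat n)) /\
  ex_series (fun k : nat => u (- Z.of_nat (S k))%Z).

Definition ZSeries (u : Z -> R) : R :=
  Series (fun n : nat => u (Z.of_nat n)) +
  Series (fun k : nat => u (- Z.of_nat (S k))%Z).

(* Integral of f from 0 to oo/C. *)
Definition jackson_improper_term (q C : R) (f : R -> R) (n : Z) : R :=
  powerRZ q n / C * f (powerRZ q n / C).

Definition ex_jackson_improper (q C : R) (f : R -> R) : Prop :=
  ex_zseries (jackson_improper_term q C f).

Definition jackson_improper (q C : R) (f : R -> R) : R :=
  (1 - q) * ZSeries (jackson_improper_term q C f).

(* Integral of f from 0 to 1. *)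
Definition ex_jackson01 (q : R) (f : R -> R) : Prop :=
  ex_series (fun n : nat => q ^ n * f (q ^ n)).

Definition jackson01 (q : R) (f : R -> R) : R :=
  (1 - q) * Series (fun n : nat => q ^ n * f (q ^ n)).

(* Integral of f from 1 to oo/1, as the sum over n <= -1.  This only involves
   f at points x > 1, so it makes sense even when f is not q-integrable near
   0; otherwise it is the difference of the two integrals above, see
   [jackson1oo_difference]. *)
Definition jackson1oo_term (q : R) (f : R -> R) (k : nat) : R :=
  powerRZ q (- Z.of_nat (S k)) * f (powerRZ q (- Z.of_nat (S k))).

Definition ex_jackson1oo (q : R) (f : R -> R) : Prop :=
  ex_series (jackson1oo_term q f).

Definition jackson1oo (q : R) (f : R -> R) : R :=
  (1 - q) * Series (jackson1oo_term q f).

Lemma jackson1oo_difference (q : R) (f : R -> R) :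
  jackson1oo q f = jackson_improper q 1 f - jackson01 q f.
Proof.
unfold jackson1oo, jackson_improper, jackson01, ZSeries.
rewrite (Series_ext (fun n : nat => jackson_improper_term q 1 f (Z.of_nat n))
                    (fun n : nat => q ^ n * f (q ^ n))).
2: { intros n; unfold jackson_improper_term.
     now rewrite <- pow_powerRZ, Rdiv_1_r. }
rewrite (Series_ext (fun k => jackson_improper_term q 1 f (- Z.of_nat (S k)))
                    (jackson1oo_term q f)).
2: { intros k; unfold jackson_improper_term, jackson1oo_term.
     now rewrite Rdiv_1_r. }
ring.
Qed.

(* Main.v *)
Require Import Defs.
From Stdlib Require Import Lia.

(* With x = q^n/A the left-hand side is a bilateral series
   psi(t) = sum over n in Z of z^n (1 + q^n t)_q^oo / (1 + q^n a)_q^oo, where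
   a = 1/A, t = q^beta/A and z = q^(alpha+1), i.e. a Ramanujan 1psi1 sum.
   Following Andrews and Askey, psi(t) is related to psi(q t) by a two-term
   recurrence whose iteration reduces the evaluation to psi(0).  At the points
   t = -q^(N+1) the series terminates on one side and is, after a shift of n by
   N, a q-binomial series; letting N tend to infinity gives psi(0).  The
   right-hand side is itself a q-binomial series, and both sides turn out to be
   the same quotient of infinite products. *)

(** * Finite and infinite q-products *)

Definition qpartial (q a : R) (N : nat) : R :=
  prod_f_R0 (fun j => 1 + q ^ j * a) N.

Lemma qpartial_S (q a : R) (N : nat) :
  qpartial q a (S N) = qpartial q a N * (1 + q ^ S N * a).
Proof. reflexivity. Qed.

Lemma qpartial_shift (q a : R) (N : nat) :
  qpartial q a (S N) = (1 + a) * qpartial q (q * a) N.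
Proof.
induction N as [|N IH].
- unfold qpartial; simpl; ring.
- rewrite qpartial_S, IH, qpartial_S; simpl; ring.
Qed.

Lemma pow_in_01 (q : R) (n : nat) : 0 < q -> q < 1 -> 0 < q ^ n <= 1.
Proof.
intros h0 h1; split; [now apply pow_lt|].
rewrite <- (pow1 n); apply pow_incr; lra.
Qed.

Lemma qpartial_pos (q a : R) (N : nat) :
  0 < q -> q < 1 -> -1 < a -> 0 < qpartial q a N.
Proof.
intros h0 h1 ha.
assert (H : forall n, 0 < 1 + q ^ n * a).
{ intros n; pose proof (pow_in_01 q n h0 h1); nra. }
induction N as [|N IH]; [apply (H 0%nat)|].
rewrite qpartial_S; apply Rmult_lt_0_compat; auto.
Qed.

(** Combines [1 + x <= exp x] with the geometric sum of the [q ^ j * a]. *)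
Lemma qpartial_le_exp (q a : R) (N : nat) :
  0 < q -> q < 1 -> 0 <= a -> qpartial q a N <= exp (a / (1 - q)).
Proof.
intros h0 h1 ha.
(* The induction needs the exact finite geometric sum; the uniform bound follows by dropping
   [q ^ S N]. *)
assert (H : qpartial q a N <= exp (a * (1 - q ^ S N) / (1 - q))).
{ induction N as [|N IH].
  - unfold qpartial; simpl.
    replace (a * (1 - q * 1) / (1 - q)) with a by (field; lra).
    pose proof (exp_ineq1_le a); lra.
  - rewrite qpartial_S.
    replace (a * (1 - q ^ S (S N)) / (1 - q))
      with (a * (1 - q ^ S N) / (1 - q) + q ^ S N * a)
      by (simpl; field; lra).
    rewrite exp_plus.
    pose proof (qpartial_pos q a N h0 h1 ltac:(lra)).
    pose proof (pow_in_01 q (S N) h0 h1).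
    apply Rmult_le_compat; [lra|nra|exact IH|].
    apply exp_ineq1_le. }
apply (Rle_trans _ _ _ H).
assert (Hm : forall x y, x <= y -> exp x <= exp y).
{ intros x y [hxy|hxy]; [left; now apply exp_increasing|subst; apply Rle_refl]. }
apply Hm, Rmult_le_compat_r; [left; apply Rinv_0_lt_compat; lra|].
pose proof (pow_in_01 q (S N) h0 h1); nra.
Qed.

Lemma pow_eventually_lt (q x y : R) :
  0 < q -> q < 1 -> 0 < y -> exists k : nat, q ^ k * x < y.
Proof.
intros h0 h1 hy.
destruct (Rle_lt_dec x 0) as [hx|hx].
{ exists 0%nat; simpl; lra. }
destruct (pow_lt_1_zero q ltac:(rewrite Rabs_pos_eq; lra) (y / x)) as [k hk].
{ apply Rdiv_lt_0_compat; lra. }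
exists k; specialize (hk k (le_n k)).
rewrite Rabs_pos_eq in hk by (left; now apply pow_lt).
apply (Rmult_lt_compat_r x) in hk; [|exact hx].
replace (y / x * x) with y in hk by (field; lra); exact hk.
Qed.

(** For [a > -1] all factors are positive and lie on one side of 1, so the partial products are
    monotone and bounded. In general, finitely many factors are split off until the remaining
    parameter [q ^ k * a] exceeds -1. *)
Lemma ex_lim_qpartial (q a : R) :
  0 < q -> q < 1 -> ex_finite_lim_seq (qpartial q a).
Proof.
intros h0 h1.
destruct (pow_eventually_lt q (- a) 1 h0 h1 ltac:(lra)) as [k hk].
assert (hk' : -1 < q ^ k * a) by lra; clear hk; revert a hk'.
induction k as [|k IH]; intros a hk.
- simpl in hk; rewrite Rmult_1_l in hk.
  destruct (Rle_lt_dec 0 a) as [ha|ha].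
  + apply ex_finite_lim_seq_incr with (exp (a / (1 - q))).
    * intros n; rewrite qpartial_S.
      pose proof (qpartial_pos q a n h0 h1 hk).
      pose proof (pow_in_01 q (S n) h0 h1).
      assert (0 <= q ^ S n * a) by nra; nra.
    * intros n; now apply qpartial_le_exp.
  + apply ex_finite_lim_seq_decr with 0.
    * intros n; rewrite qpartial_S.
      pose proof (qpartial_pos q a n h0 h1 hk).
      pose proof (pow_in_01 q (S n) h0 h1).
      assert (q ^ S n * a <= 0) by nra; nra.
    * intros n; left; now apply qpartial_pos.
- destruct (IH (q * a)) as [l hl].
  { simpl in hk; replace (q ^ k * (q * a)) with (q * q ^ k * a) by ring; exact hk. }
  exists ((1 + a) * l).
  apply is_lim_seq_incr_1.
  apply is_lim_seq_ext with (fun n => (1 + a) * qpartial q (q * a) n).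
  { intros n; now rewrite qpartial_shift. }
  apply (is_lim_seq_scal_l _ (1 + a) l hl).
Qed.

Lemma is_lim_qpartial (q a : R) :
  0 < q -> q < 1 -> is_lim_seq (qpartial q a) (qprod_inf q a).
Proof. intros h0 h1; apply Lim_seq_correct', (ex_lim_qpartial q a h0 h1). Qed.

Lemma qprod_inf_rec (q a : R) :
  0 < q -> q < 1 -> qprod_inf q a = (1 + a) * qprod_inf q (q * a).
Proof.
intros h0 h1.
pose proof (is_lim_qpartial q a h0 h1) as H1.
apply is_lim_seq_incr_1, is_lim_seq_unique in H1.
pose proof (is_lim_seq_scal_l _ (1 + a) _ (is_lim_qpartial q (q * a) h0 h1)) as H2.
apply (is_lim_seq_ext _ (fun n => qpartial q a (S n))) in H2.
2: { intros n; now rewrite qpartial_shift. }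
apply is_lim_seq_unique in H2; rewrite H1 in H2; simpl in H2.
now injection H2.
Qed.

Lemma qprod_inf_0 (q : R) : 0 < q -> q < 1 -> qprod_inf q 0 = 1.
Proof.
intros h0 h1.
pose proof (is_lim_seq_unique _ _ (is_lim_qpartial q 0 h0 h1)) as H.
rewrite (Lim_seq_ext _ (fun _ => 1)), Lim_seq_const in H.
- now injection H.
- induction n as [|n IH]; [unfold qpartial; simpl; ring|].
  rewrite qpartial_S, IH; ring.
Qed.

(** The parameter [- a / (1 + a)] makes the two first factors reciprocal, and every later pair has
    product at least 1. This keeps the partial products for negative [a] away from 0. *)
Lemma qpartial_mul_ge1 (q a : R) (N : nat) :
  0 < q -> q < 1 -> -1 < a -> a <= 0 ->
  1 <= qpartial q a N * qpartial q (- a / (1 + a)) N.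
Proof.
intros h0 h1 ha ha0.
assert (H : forall n, 1 <= (1 + q ^ n * a) * (1 + q ^ n * (- a / (1 + a)))).
{ intros n; destruct (pow_in_01 q n h0 h1) as [hp hp1].
  replace ((1 + q ^ n * a) * (1 + q ^ n * (- a / (1 + a))))
    with (1 + q ^ n * (1 - q ^ n) * (a ^ 2 / (1 + a))) by (field; lra).
  assert (0 <= a ^ 2 / (1 + a)).
  { apply Rmult_le_pos; [nra|left; apply Rinv_0_lt_compat; lra]. }
  assert (0 <= q ^ n * (1 - q ^ n)) by nra.
  nra. }
induction N as [|N IH]; [apply (H 0%nat)|].
rewrite !qpartial_S.
pose proof (H (S N)); nra.
Qed.

(** Positive partial products only give a nonnegative limit. For [a >= 0] they are at least 1; for
    [a < 0] a zero limit would contradict [qpartial_mul_ge1]. *)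
Lemma qprod_inf_pos (q a : R) :
  0 < q -> q < 1 -> -1 < a -> 0 < qprod_inf q a.
Proof.
intros h0 h1 ha.
destruct (Rle_lt_dec 0 a) as [ha0|ha0].
- apply Rlt_le_trans with 1; [lra|].
  assert (H : Rbar_le 1 (qprod_inf q a)); [|exact H].
  apply is_lim_seq_le with (fun _ : nat => 1) (qpartial q a);
    [|apply is_lim_seq_const|now apply is_lim_qpartial].
  intros n; induction n as [|n IH]; [unfold qpartial; simpl; lra|].
  rewrite qpartial_S; pose proof (pow_in_01 q (S n) h0 h1).
  assert (0 <= q ^ S n * a) by nra; nra.
- assert (Hp : 0 <= qprod_inf q a).
  { assert (H : Rbar_le 0 (qprod_inf q a)); [|exact H].
    apply is_lim_seq_le with (fun _ : nat => 0) (qpartial q a);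
      [|apply is_lim_seq_const|now apply is_lim_qpartial].
    intros n; left; now apply qpartial_pos. }
  assert (H : Rbar_le 1 (qprod_inf q a * qprod_inf q (- a / (1 + a)))).
  { apply is_lim_seq_le with (fun _ : nat => 1)
      (fun n => qpartial q a n * qpartial q (- a / (1 + a)) n).
    - intros n; apply qpartial_mul_ge1; lra.
    - apply is_lim_seq_const.
    - apply is_lim_seq_mult'; now apply is_lim_qpartial. }
  simpl in H; destruct Hp as [Hp|Hp]; [exact Hp|rewrite <- Hp in H; lra].
Qed.

(* Convexity in [c] of a product with nonnegative coefficients: this is what
   makes [psi] continuous at [t = 0] with an explicit modulus. *)
Lemma qprod_inf_sub1_le (q c x y : R) :
  0 < q -> q < 1 -> 0 <= c <= 1 -> 0 <= y -> Rabs x <= c * y ->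
  Rabs (qprod_inf q x - 1) <= c * (qprod_inf q y - 1).
Proof.
intros h0 h1 hc hy hx.
assert (H : Rbar_le (Rabs (qprod_inf q x - 1)) (c * (qprod_inf q y - 1)));
  [|exact H].
apply is_lim_seq_le with (fun n => Rabs (qpartial q x n - 1))
  (fun n => c * (qpartial q y n - 1)).
- induction n as [|n IH].
  + unfold qpartial; simpl.
    replace (1 + 1 * x - 1) with x by ring.
    replace (1 + 1 * y - 1) with y by ring; exact hx.
  + rewrite !qpartial_S.
    set (X := qpartial q x n) in *; set (Y := qpartial q y n) in *.
    destruct (pow_in_01 q (S n) h0 h1) as [hp hp1]; set (w := q ^ S n) in *.
    replace (X * (1 + w * x) - 1)
      with ((X - 1) + (w * x + (X - 1) * (w * x))) by ring.
    pose proof (Rabs_pos (X - 1)) as hX; pose proof (Rabs_pos x) as hx0.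
    eapply Rle_trans; [apply Rabs_triang|].
    eapply Rle_trans; [apply Rplus_le_compat_l, Rabs_triang|].
    rewrite !Rabs_mult, (Rabs_pos_eq w) by lra.
    set (D := Rabs (X - 1)) in *; set (e := Rabs x) in *.
    assert (he : w * e <= c * (w * y)) by nra.
    assert (0 <= w * e) by nra.
    (* The induction hypothesis only gives [c * (Y - 1) >= 0], so [c = 0], where all the bounds
       vanish, is treated apart. *)
    assert (hY : 0 <= Y - 1 \/ c = 0).
    { destruct (Rle_lt_dec c 0); [right; lra|left].
      apply Rmult_le_reg_l with c; lra. }
    assert (hD : D * (w * e) <= c * (Y - 1) * (c * (w * y))).
    { apply Rmult_le_compat; auto. }
    assert (0 <= w * y) by nra.
    destruct hY as [hY|hY].
    * assert (c * (Y - 1) * (c * (w * y)) <= c * ((Y - 1) * (w * y))).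
      { assert (0 <= c * ((Y - 1) * (w * y))).
        { apply Rmult_le_pos; [lra|now apply Rmult_le_pos]. }
        replace (c * (Y - 1) * (c * (w * y)))
          with (c * (c * ((Y - 1) * (w * y)))) by ring; nra. }
      nra.
    * subst c; lra.
- apply (is_lim_seq_abs _ (qprod_inf q x - 1)).
  apply is_lim_seq_minus'; [now apply is_lim_qpartial|apply is_lim_seq_const].
- apply (is_lim_seq_scal_l _ c (qprod_inf q y - 1)).
  apply is_lim_seq_minus'; [now apply is_lim_qpartial|apply is_lim_seq_const].
Qed.

(** * The q-binomial theorem *)

Lemma is_lim_seq_pow_scal (q c : R) :
  0 < q -> q < 1 -> is_lim_seq (fun n => q ^ n * c) 0.
Proof.
intros h0 h1.
replace (Finite 0) with (Rbar_mult 0 c) by (simpl; f_equal; ring).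
apply is_lim_seq_scal_r, is_lim_seq_geom; rewrite Rabs_pos_eq; lra.
Qed.

(** Up to a constant the coefficient of [z ^ m] is (-a;q)_m / (q;q)_m. Its recurrence in [m] becomes
    the functional equation [(1 - x) B(x) = (1 + x a) B(q x)], which is iterated from [z] down to
    0. *)
Lemma qbinomial (q a z : R) :
  0 < q -> q < 1 -> -1 < a -> 0 < z -> z < 1 ->
  let u := fun m : nat =>
    qprod_inf q (- q ^ S m) / qprod_inf q (q ^ m * a) * z ^ m in
  ex_series u /\
  Series u = qprod_inf q (- q) * qprod_inf q (z * a) /
             (qprod_inf q a * qprod_inf q (- z)).
Proof.
intros h0 h1 ha hz0 hz1 u.
set (w := fun m : nat => qprod_inf q (- q ^ S m) / qprod_inf q (q ^ m * a)).
assert (hqm : forall m, 0 < q ^ m <= 1) by (intros; now apply pow_in_01).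
assert (hqa : forall m, 0 < 1 + q ^ m * a) by (intros m; specialize (hqm m); nra).
assert (hqS : forall m, 0 < 1 - q ^ S m)
  by (intros m; specialize (hqm m); simpl; nra).
assert (hPa : forall m, 0 < qprod_inf q (q ^ m * a)).
{ intros m; apply qprod_inf_pos; try lra; specialize (hqa m); lra. }
assert (hPq : forall m, 0 < qprod_inf q (- q ^ S m)).
{ intros m; apply qprod_inf_pos; try lra; specialize (hqS m); lra. }
assert (hw0 : forall m, w m <> 0).
{ intros m; apply Rgt_not_eq, Rdiv_lt_0_compat; auto. }
assert (hw : forall m, w (S m) * (1 - q ^ S m) = w m * (1 + q ^ m * a)).
{ intros m; unfold w.
  rewrite (qprod_inf_rec q (- q ^ S m)), (qprod_inf_rec q (q ^ m * a)) by lra.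
  replace (q * (q ^ m * a)) with (q ^ S m * a) by (simpl; ring).
  replace (q * - q ^ S m) with (- q ^ S (S m)) by (simpl; ring).
  field; split; [apply Rgt_not_eq, hPa|apply Rgt_not_eq, hqa]. }
(* By [hw] the ratio of consecutive coefficients is [(1 + q ^ m * a) / (1 - q ^ S m)], which tends
   to 1. *)
assert (hCV : CV_radius w = 1).
{ replace (Finite 1) with (Finite (/ 1)) by (f_equal; field).
  apply CV_radius_finite_DAlembert; [exact hw0|lra|].
  apply is_lim_seq_ext with (fun m => Rabs ((1 + q ^ m * a) / (1 + q ^ m * - q))).
  { intros m; f_equal.
    replace (1 + q ^ m * - q) with (1 - q ^ S m) by (simpl; ring).
    pose proof (hw m); pose proof (hw0 m); pose proof (hqS m).
    apply Rmult_eq_reg_r with (w m * (1 - q ^ S m)).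
    2: { apply Rmult_integral_contrapositive; split; [auto|lra]. }
    transitivity (w m * (1 + q ^ m * a)); [field; lra|].
    rewrite <- H; field; auto. }
  replace (Finite 1) with (Finite (Rabs ((1 + 0) / (1 + 0))))
    by (f_equal; rewrite Rabs_pos_eq; lra).
  apply (is_lim_seq_abs _ ((1 + 0) / (1 + 0))).
  apply is_lim_seq_div'; [| |lra];
    (apply is_lim_seq_plus'; [apply is_lim_seq_const|now apply is_lim_seq_pow_scal]). }
assert (hex : forall x, 0 <= x < 1 -> ex_series (fun m => w m * x ^ m)).
{ intros x hx; apply ex_series_Rabs, CV_disk_inside.
  rewrite hCV, Rabs_pos_eq; simpl; lra. }
set (B := fun x => Series (fun m => w m * x ^ m)).
assert (hB : forall x, 0 <= x < 1 -> (1 - x) * B x = (1 + x * a) * B (q * x)).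
{ intros x hx.
  assert (hqx : 0 <= q * x < 1) by nra.
  (* In this form coefficients can be compared: on the left the constant term cancels, and [hw]
     rewrites the coefficient of [x ^ S m]. *)
  assert (H : B x - B (q * x) = x * B x + a * x * B (q * x)); [|lra].
  unfold B; rewrite <- !Series_scal_l, <- Series_plus, <- Series_minus by
    (try apply hex; auto; apply (ex_series_scal_l (K := R_AbsRing) (V := R_NormedModule)); auto).
  rewrite Series_incr_1.
  2: { apply (ex_series_minus (K := R_AbsRing) (V := R_NormedModule)); auto. }
  simpl pow at 1 2; rewrite Rminus_diag, Rplus_0_l.
  apply Series_ext; intros m.
  replace (w (S m) * x ^ S m - w (S m) * (q * x) ^ S m)
    with ((w (S m) * (1 - q ^ S m)) * x ^ S m)
    by (rewrite Rpow_mult_distr; ring).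
  rewrite hw, Rpow_mult_distr; simpl; ring. }
assert (hBn : forall N,
  qpartial q (- z) N * B z = qpartial q (z * a) N * B (q ^ S N * z)).
{ induction N as [|N IH].
  - pose proof (hB z ltac:(lra)); unfold qpartial; simpl.
    rewrite Rmult_1_r; lra.
  - rewrite !qpartial_S.
    destruct (hqm (S N)) as [hp hp1].
    pose proof (hB (q ^ S N * z) ltac:(nra)) as H.
    replace (q ^ S (S N) * z) with (q * (q ^ S N * z)) by (simpl; ring).
    replace (qpartial q (- z) N * (1 + q ^ S N * - z) * B z)
      with ((1 - q ^ S N * z) * (qpartial q (- z) N * B z)) by ring.
    rewrite IH.
    transitivity (qpartial q (z * a) N * ((1 - q ^ S N * z) * B (q ^ S N * z)));
      [ring|].
    rewrite H; ring. }
(* A power series is continuous inside its disk, and its value at 0 is the constant coefficient. *)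
assert (hB0 : is_lim_seq (fun N => B (q ^ S N * z)) (w 0%nat)).
{ replace (w 0%nat) with (B 0) by (apply (PSeries_0 w)).
  apply (is_lim_seq_continuous B).
  - apply PSeries_continuity; rewrite hCV, Rabs_R0; simpl; lra.
  - apply (is_lim_seq_incr_1 (fun N => q ^ N * z)).
    now apply is_lim_seq_pow_scal. }
split; [apply hex; lra|].
assert (H : qprod_inf q (- z) * B z = qprod_inf q (z * a) * w 0%nat).
{ assert (Hl : is_lim_seq (fun N => qpartial q (- z) N * B z)
                 (qprod_inf q (- z) * B z)).
  { apply is_lim_seq_mult'; [now apply is_lim_qpartial|apply is_lim_seq_const]. }
  apply is_lim_seq_ext with
    (v := fun N => qpartial q (z * a) N * B (q ^ S N * z)) in Hl; [|exact hBn].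
  apply is_lim_seq_unique in Hl.
  rewrite (is_lim_seq_unique _ (qprod_inf q (z * a) * w 0%nat)) in Hl.
  - now injection Hl.
  - apply is_lim_seq_mult'; [now apply is_lim_qpartial|exact hB0]. }
assert (hz : 0 < qprod_inf q (- z)) by (apply qprod_inf_pos; lra).
assert (ha' : 0 < qprod_inf q a) by now apply qprod_inf_pos.
change (Series u) with (B z).
apply Rmult_eq_reg_l with (qprod_inf q (- z)); [|lra].
rewrite H; unfold w; simpl; rewrite Rmult_1_r, Rmult_1_l.
field; lra.
Qed.

(** * Series over all integers *)

Lemma ZSeries_ext (u v : Z -> R) : (forall n, u n = v n) -> ZSeries u = ZSeries v.
Proof. intros h; unfold ZSeries; f_equal; apply Series_ext; intros; apply h. Qed.

Lemma ex_zseries_ext (u v : Z -> R) :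
  (forall n, u n = v n) -> ex_zseries u -> ex_zseries v.
Proof.
intros h [h1 h2]; split; [refine (ex_series_ext _ _ _ h1)|refine (ex_series_ext _ _ _ h2)];
  intros; apply h.
Qed.

Lemma ZSeries_scal (c : R) (u : Z -> R) :
  ZSeries (fun n => c * u n) = c * ZSeries u.
Proof. unfold ZSeries; rewrite !Series_scal_l; ring. Qed.

Lemma ex_zseries_scal (c : R) (u : Z -> R) :
  ex_zseries u -> ex_zseries (fun n => c * u n).
Proof.
intros [h1 h2]; split;
  apply (ex_series_scal_l (K := R_AbsRing) (V := R_NormedModule)); assumption.
Qed.

Lemma ZSeries_minus (u v : Z -> R) :
  ex_zseries u -> ex_zseries v ->
  ZSeries (fun n => u n - v n) = ZSeries u - ZSeries v.
Proof.
intros [h1 h2] [h3 h4]; unfold ZSeries; rewrite !Series_minus by assumption; ring.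
Qed.

Lemma ex_zseries_minus (u v : Z -> R) :
  ex_zseries u -> ex_zseries v -> ex_zseries (fun n => u n - v n).
Proof.
intros [h1 h2] [h3 h4]; split;
  apply (ex_series_minus (K := R_AbsRing) (V := R_NormedModule)); assumption.
Qed.

Lemma ex_zseries_le (u v : Z -> R) :
  (forall n, Rabs (u n) <= v n) -> ex_zseries v -> ex_zseries u.
Proof.
intros h [h1 h2]; split;
  [refine (ex_series_le (V := R_CompleteNormedModule) _ _ _ h1)
  |refine (ex_series_le (V := R_CompleteNormedModule) _ _ _ h2)]; intros; apply h.
Qed.

Lemma Rabs_ZSeries_le (u v : Z -> R) :
  (forall n, Rabs (u n) <= v n) -> ex_zseries v -> Rabs (ZSeries u) <= ZSeries v.
Proof.
intros h hv.
destruct (ex_zseries_le (fun n => Rabs (u n)) v) as [h1 h2]; [|exact hv|].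
{ intros n; rewrite Rabs_Rabsolu; apply h. }
destruct hv as [hv1 hv2]; unfold ZSeries.
eapply Rle_trans; [apply Rabs_triang|].
apply Rplus_le_compat;
  (eapply Rle_trans; [apply Series_Rabs; assumption|]);
  apply Series_le; auto; intros; split; auto using Rabs_pos.
Qed.

(** The shift moves the single term [u 0] from the nonnegative half to the negative half. *)
Lemma ZSeries_succ (u : Z -> R) :
  ex_zseries u ->
  ex_zseries (fun n => u (n + 1)%Z) /\ ZSeries (fun n => u (n + 1)%Z) = ZSeries u.
Proof.
intros [h1 h2].
assert (e1 : forall n : nat, u (Z.of_nat (S n)) = u (Z.of_nat n + 1)%Z)
  by (intros; f_equal; lia).
assert (e2 : forall k : nat,
  u (- Z.of_nat (S k))%Z = u (- Z.of_nat (S (S k)) + 1)%Z)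
  by (intros; f_equal; lia).
assert (hn : ex_series (fun k : nat => u (- Z.of_nat (S k) + 1)%Z)).
{ apply ex_series_incr_1; eapply ex_series_ext; [|exact h2]; exact e2. }
split; [split; [|exact hn]|].
- apply ex_series_incr_1 in h1; eapply ex_series_ext; [|exact h1]; exact e1.
- unfold ZSeries.
  rewrite (Series_incr_1 _ h1), (Series_incr_1 _ hn).
  rewrite (Series_ext _ _ e1), (Series_ext _ _ e2).
  simpl; ring.
Qed.

(** * The bilateral series: convergence, continuity at 0, recurrence in [t] *)

Definition psi_term (q z a t : R) (n : Z) : R :=
  powerRZ z n * (qprod_inf q (powerRZ q n * t) / qprod_inf q (powerRZ q n * a)).

(* Ramanujan's bilateral series 1psi1(- a; - t; q, z), up to the factor
   [qprod_inf q t / qprod_inf q a]. *)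
Definition psi (q z a t : R) : R := ZSeries (psi_term q z a t).

Lemma qprod_inf_powerRZ_pos (q a : R) (n : Z) :
  0 < q -> q < 1 -> 0 <= a -> 0 < qprod_inf q (powerRZ q n * a).
Proof.
intros h0 h1 ha; apply qprod_inf_pos; try lra.
pose proof (powerRZ_lt q n h0); nra.
Qed.

Lemma qprod_inf_powerRZ_rec (q a : R) (n : Z) :
  0 < q -> q < 1 ->
  qprod_inf q (powerRZ q n * a) =
  (1 + powerRZ q n * a) * qprod_inf q (powerRZ q (n + 1) * a).
Proof.
intros h0 h1; rewrite qprod_inf_rec by lra; do 2 f_equal.
rewrite powerRZ_add, powerRZ_1 by lra; ring.
Qed.

(** Feeds the ratio tests; cross-multiplied because [1 + powerRZ q n * t] may vanish for negative
    [t]. *)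
Lemma psi_term_succ (q z a t : R) (n : Z) :
  0 < q -> q < 1 -> 0 < z -> 0 <= a ->
  psi_term q z a t (n + 1) * (1 + powerRZ q n * t) =
  z * (1 + powerRZ q n * a) * psi_term q z a t n.
Proof.
intros h0 h1 hz ha; unfold psi_term.
rewrite (qprod_inf_powerRZ_rec q t n), (qprod_inf_powerRZ_rec q a n) by lra.
pose proof (qprod_inf_powerRZ_pos q a (n + 1) h0 h1 ha).
pose proof (powerRZ_lt q n h0).
rewrite (powerRZ_add z), powerRZ_1 by lra.
field; split; nra.
Qed.

Lemma is_lim_pow_ratio (q c d c' d' : R) :
  0 < q -> q < 1 -> c' <> 0 ->
  is_lim_seq (fun n => (c + q ^ n * d) / (c' + q ^ n * d')) (c / c').
Proof.
intros h0 h1 hc.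
replace (c / c') with ((c + 0) / (c' + 0)) by (now rewrite !Rplus_0_r).
apply is_lim_seq_div'; [| |lra];
  (apply is_lim_seq_plus'; [apply is_lim_seq_const|now apply is_lim_seq_pow_scal]).
Qed.

(** Ratio test on each half: the ratios tend to [z] towards plus infinity and to [t / (z * a)]
    towards minus infinity, whence the condition [t < a * z]. *)
Lemma ex_psi_pos (q z a t : R) :
  0 < q -> q < 1 -> 0 < z -> z < 1 -> 0 < a -> 0 < t -> t < a * z ->
  ex_zseries (psi_term q z a t).
Proof.
intros h0 h1 hz0 hz1 ha ht hta.
assert (hp : forall n, 0 < psi_term q z a t n).
{ intros n; apply Rmult_lt_0_compat; [now apply powerRZ_lt|].
  apply Rdiv_lt_0_compat; apply qprod_inf_powerRZ_pos; lra. }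
split; apply ex_series_Rabs.
- apply ex_series_DAlembert with (z / 1); [lra|intros n; apply Rgt_not_eq, hp|].
  apply is_lim_seq_ext with (fun n => Rabs ((z + q ^ n * (z * a)) / (1 + q ^ n * t))).
  { intros n; f_equal.
    pose proof (hp (Z.of_nat n)) as H1.
    pose proof (psi_term_succ q z a t (Z.of_nat n) h0 h1 hz0 ltac:(lra)) as H.
    replace (Z.of_nat (S n)) with (Z.of_nat n + 1)%Z by lia.
    rewrite <- pow_powerRZ in H.
    pose proof (pow_lt q n h0).
    apply Rmult_eq_reg_r with ((1 + q ^ n * t) * psi_term q z a t (Z.of_nat n)).
    2: { apply Rmult_integral_contrapositive; split; nra. }
    transitivity (z * (1 + q ^ n * a) * psi_term q z a t (Z.of_nat n)).
    - field; nra.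
    - rewrite <- H; field; nra. }
  replace (Finite (z / 1)) with (Finite (Rabs (z / 1)))
    by (f_equal; rewrite Rabs_pos_eq; lra).
  apply (is_lim_seq_abs _ (z / 1)), is_lim_pow_ratio; lra.
- apply ex_series_DAlembert with (t / (z * a)); [|intros n; apply Rgt_not_eq, hp|].
  { apply Rmult_lt_reg_r with (z * a); [nra|].
    replace (t / (z * a) * (z * a)) with t by (field; lra); lra. }
  (* Entry [k] of this half has index [-(k + 1)], so its successor has index [n = -(k + 2)];
     clearing [powerRZ q n] produces the [q ^ 2]. *)
  apply is_lim_seq_ext with
    (fun n => Rabs ((t + q ^ n * q ^ 2) / (z * a + q ^ n * (z * q ^ 2)))).
  { intros k; f_equal.
    set (n := (- Z.of_nat (S (S k)))%Z).
    pose proof (hp n) as H1.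
    pose proof (psi_term_succ q z a t n h0 h1 hz0 ltac:(lra)) as H.
    replace (- Z.of_nat (S k))%Z with (n + 1)%Z by lia.
    pose proof (hp (n + 1)%Z) as H2.
    assert (hq : powerRZ q n = / (q ^ k * q ^ 2)).
    { unfold n; rewrite powerRZ_neg', <- pow_powerRZ by lra.
      f_equal; simpl; ring. }
    rewrite hq in H.
    pose proof (pow_lt q k h0).
    assert (0 < q ^ 2) by (apply pow_lt; lra).
    assert (0 < q ^ k * q ^ 2) by nra.
    set (y := q ^ k * q ^ 2) in *.
    replace (q ^ k * (z * q ^ 2)) with (z * y) by (unfold y; ring).
    assert (0 < z * a + z * y) by nra.
    apply Rmult_eq_reg_r with ((z * a + z * y) * psi_term q z a t (n + 1)).
    2: { apply Rmult_integral_contrapositive; split; lra. }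
    transitivity (psi_term q z a t (n + 1) * (1 + / y * t) * y).
    - field; lra.
    - rewrite H; field; lra. }
  assert (0 < t / (z * a)) by (apply Rdiv_lt_0_compat; nra).
  replace (Finite (t / (z * a))) with (Finite (Rabs (t / (z * a))))
    by (f_equal; rewrite Rabs_pos_eq; lra).
  apply (is_lim_seq_abs _ (t / (z * a))), is_lim_pow_ratio; nra.
Qed.

(** This is [qprod_inf_sub1_le] with [c = |t| / d] and [y = q^n d], times a positive weight; [c]
    does not depend on [n], so the bound can be summed. *)
Lemma psi_term_sub0_le (q z a t d : R) (n : Z) :
  0 < q -> q < 1 -> 0 < z -> 0 < a -> 0 < d -> Rabs t <= d ->
  Rabs (psi_term q z a t n - psi_term q z a 0 n) <=
  Rabs t / d * (psi_term q z a d n - psi_term q z a 0 n).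
Proof.
intros h0 h1 hz ha hd htd; unfold psi_term.
rewrite Rmult_0_r, qprod_inf_0 by lra.
pose proof (qprod_inf_powerRZ_pos q a n h0 h1 ltac:(lra)) as hP.
set (P := qprod_inf q (powerRZ q n * a)) in *.
pose proof (powerRZ_lt q n h0) as hq.
assert (hw : 0 < powerRZ z n / P).
{ apply Rdiv_lt_0_compat; [now apply powerRZ_lt|exact hP]. }
set (X := qprod_inf q (powerRZ q n * t)).
set (Y := qprod_inf q (powerRZ q n * d)).
replace (powerRZ z n * (X / P) - powerRZ z n * (1 / P))
  with (powerRZ z n / P * (X - 1)) by (field; lra).
replace (powerRZ z n * (Y / P) - powerRZ z n * (1 / P))
  with (powerRZ z n / P * (Y - 1)) by (field; lra).
rewrite Rabs_mult, (Rabs_pos_eq (powerRZ z n / P)) by lra.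
assert (Rabs (X - 1) <= Rabs t / d * (Y - 1)); [|nra].
pose proof (Rabs_pos t).
apply qprod_inf_sub1_le; try lra.
- split.
  + apply Rmult_le_pos; [lra|left; apply Rinv_0_lt_compat; lra].
  + apply Rmult_le_reg_r with d; [lra|].
    replace (Rabs t / d * d) with (Rabs t) by (field; lra); lra.
- nra.
- rewrite Rabs_mult, (Rabs_pos_eq (powerRZ q n)) by lra.
  right; field; lra.
Qed.

Lemma ex_psi0 (q z a : R) :
  0 < q -> q < 1 -> 0 < z -> z < 1 -> 0 < a -> ex_zseries (psi_term q z a 0).
Proof.
intros h0 h1 hz0 hz1 ha.
(* Any [d] strictly between 0 and [a * z] would do: the series converges there and dominates the one
   at 0. *)
set (d := a * z / 2).
assert (hd : 0 < d < a * z) by (unfold d; split; nra).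
apply ex_zseries_le with (psi_term q z a d); [|apply ex_psi_pos; lra].
intros n; unfold psi_term.
rewrite Rmult_0_r, qprod_inf_0 by lra.
pose proof (qprod_inf_powerRZ_pos q a n h0 h1 ltac:(lra)) as hP.
pose proof (powerRZ_lt z n hz0) as hz.
pose proof (powerRZ_lt q n h0) as hq.
(* [qprod_inf_sub1_le] at [c = 1], [x = 0] has the nonnegative left side needed here. *)
assert (h : 1 <= qprod_inf q (powerRZ q n * d)).
{ pose proof (qprod_inf_sub1_le q 1 0 (powerRZ q n * d) h0 h1 ltac:(lra)
    ltac:(nra) ltac:(rewrite Rabs_R0; nra)) as H.
  pose proof (Rabs_pos (qprod_inf q 0 - 1)); lra. }
assert (hiP : 0 < / qprod_inf q (powerRZ q n * a)) by now apply Rinv_0_lt_compat.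
rewrite Rabs_pos_eq; unfold Rdiv.
- apply Rmult_le_compat_l; [lra|]; apply Rmult_le_compat_r; lra.
- apply Rmult_le_pos; lra.
Qed.

(** The difference from the convergent series at 0 is dominated termwise, which also gives
    convergence for negative [t]; the estimate is linear in [|t|]. *)
Lemma psi_sub0 (q z a t d : R) :
  0 < q -> q < 1 -> 0 < z -> z < 1 -> 0 < a -> 0 < d -> d < a * z -> Rabs t <= d ->
  ex_zseries (psi_term q z a t) /\
  Rabs (psi q z a t - psi q z a 0) <= Rabs t / d * (psi q z a d - psi q z a 0).
Proof.
intros h0 h1 hz0 hz1 ha hd0 hd ht.
pose proof (ex_psi0 q z a h0 h1 hz0 hz1 ha) as e0.
pose proof (ex_psi_pos q z a d h0 h1 hz0 hz1 ha hd0 hd) as ed.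
pose proof (fun n => psi_term_sub0_le q z a t d n h0 h1 hz0 ha hd0 ht) as hle.
assert (eb := ex_zseries_scal (Rabs t / d) _ (ex_zseries_minus _ _ ed e0)).
assert (et : ex_zseries (psi_term q z a t)).
{ assert (es := ex_zseries_le _ _ hle eb).
  refine (ex_zseries_ext _ _ _
    (ex_zseries_minus _ _ es (ex_zseries_scal (-1) _ e0))).
  intros n; simpl; ring. }
split; [exact et|].
unfold psi; rewrite <- (ZSeries_minus _ _ et e0), <- (ZSeries_minus _ _ ed e0).
rewrite <- ZSeries_scal; now apply Rabs_ZSeries_le.
Qed.

Lemma is_lim_psi0 (q z a : R) (t : nat -> R) :
  0 < q -> q < 1 -> 0 < z -> z < 1 -> 0 < a ->
  is_lim_seq t 0 -> is_lim_seq (fun n => psi q z a (t n)) (psi q z a 0).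
Proof.
intros h0 h1 hz0 hz1 ha ht.
set (d := a * z / 2).
assert (hd : 0 < d < a * z) by (unfold d; split; nra).
assert (hab : is_lim_seq (fun n => psi q z a (t n) - psi q z a 0) 0).
{ apply is_lim_seq_abs_0.
  apply is_lim_seq_le_le_loc with (fun _ => 0)
    (fun n => Rabs (t n) / d * (psi q z a d - psi q z a 0)).
  - apply is_lim_seq_spec in ht.
    destruct (ht (mkposreal d (proj1 hd))) as [N hN].
    exists N; intros n hn; split; [apply Rabs_pos|].
    specialize (hN n hn); simpl in hN; rewrite Rminus_0_r in hN.
    apply psi_sub0; lra.
  - apply is_lim_seq_const.
  - replace (Finite 0) with (Rbar_mult (Rbar_mult 0 (/ d)) (psi q z a d - psi q z a 0))
      by (simpl; f_equal; ring).
    apply is_lim_seq_scal_r, is_lim_seq_scal_r.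
    exact (proj1 (is_lim_seq_abs_0 t) ht). }
apply is_lim_seq_ext with (fun n => psi q z a (t n) - psi q z a 0 + psi q z a 0).
{ intros n; ring. }
replace (Finite (psi q z a 0)) with (Finite (0 + psi q z a 0)) by (f_equal; ring).
apply is_lim_seq_plus'; [exact hab|apply is_lim_seq_const].
Qed.

(* Termwise, [c_n(t) - t / (z a) c_(n+1)(t) = (1 - t / a) c_n(q t)] for the terms
   [c_n] of [psi]; then shift the second sum. *)
Lemma psi_mul_q (q z a t : R) :
  0 < q -> q < 1 -> 0 < z -> z < 1 -> 0 < a -> Rabs t < a * z ->
  (1 - t / (z * a)) * psi q z a t = (1 - t / a) * psi q z a (q * t).
Proof.
intros h0 h1 hz0 hz1 ha ht.
assert (het : ex_zseries (psi_term q z a t)).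
{ set (d := (Rabs t + a * z) / 2); pose proof (Rabs_pos t).
  apply (psi_sub0 q z a t d); unfold d; lra. }
destruct (ZSeries_succ _ het) as [hes hs].
assert (H : psi q z a t - t / (z * a) * psi q z a t = (1 - t / a) * psi q z a (q * t));
  [|lra].
unfold psi at 1 2; rewrite <- hs at 2.
rewrite <- ZSeries_scal, <- ZSeries_minus by (try apply ex_zseries_scal; assumption).
unfold psi; rewrite <- ZSeries_scal; apply ZSeries_ext; intros n.
unfold psi_term.
rewrite (qprod_inf_powerRZ_rec q t n), (qprod_inf_powerRZ_rec q a n) by lra.
pose proof (qprod_inf_powerRZ_pos q a (n + 1) h0 h1 ltac:(lra)).
pose proof (powerRZ_lt q n h0).
replace (powerRZ q n * (q * t)) with (powerRZ q (n + 1) * t)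
  by (rewrite powerRZ_add, powerRZ_1 by lra; ring).
rewrite (powerRZ_add z), powerRZ_1 by lra.
field; repeat split; nra.
Qed.

(** Iterating [psi_mul_q] collects partial products on both sides and moves the argument to
    [q ^ S N * t]; [is_lim_psi0] handles its limit. *)
Lemma psi_reduce (q z a t : R) :
  0 < q -> q < 1 -> 0 < z -> z < 1 -> 0 < a -> Rabs t < a * z ->
  qprod_inf q (- (t / (z * a))) * psi q z a t = qprod_inf q (- (t / a)) * psi q z a 0.
Proof.
intros h0 h1 hz0 hz1 ha ht.
assert (H : forall N, qpartial q (- (t / (z * a))) N * psi q z a t =
  qpartial q (- (t / a)) N * psi q z a (q ^ S N * t)).
{ induction N as [|N IH].
  - unfold qpartial; simpl; rewrite Rmult_1_r.
    pose proof (psi_mul_q q z a t h0 h1 hz0 hz1 ha ht); lra.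
  - rewrite !qpartial_S.
    replace (q ^ S (S N) * t) with (q * (q ^ S N * t)) by (simpl; ring).
    transitivity ((1 - q ^ S N * t / (z * a)) *
      (qpartial q (- (t / (z * a))) N * psi q z a t)); [field; lra|].
    rewrite IH.
    transitivity (qpartial q (- (t / a)) N *
      ((1 - q ^ S N * t / (z * a)) * psi q z a (q ^ S N * t))); [ring|].
    rewrite psi_mul_q by (try lra; rewrite Rabs_mult, Rabs_pos_eq;
      pose proof (pow_in_01 q (S N) h0 h1); pose proof (Rabs_pos t); nra).
    field; lra. }
assert (L1 : is_lim_seq (fun N => qpartial q (- (t / (z * a))) N * psi q z a t)
  (qprod_inf q (- (t / (z * a))) * psi q z a t)).
{ apply is_lim_seq_mult'; [now apply is_lim_qpartial|apply is_lim_seq_const]. }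
apply is_lim_seq_ext with
  (v := fun N => qpartial q (- (t / a)) N * psi q z a (q ^ S N * t)) in L1; [|exact H].
assert (L2 : is_lim_seq (fun N => qpartial q (- (t / a)) N * psi q z a (q ^ S N * t))
  (qprod_inf q (- (t / a)) * psi q z a 0)).
{ apply is_lim_seq_mult'; [now apply is_lim_qpartial|].
  apply is_lim_psi0; auto.
  apply (is_lim_seq_incr_1 (fun N => q ^ N * t)); now apply is_lim_seq_pow_scal. }
apply is_lim_seq_unique in L1, L2; rewrite L1 in L2; now injection L2.
Qed.

(** * Evaluation of the bilateral series at the terminating points and at 0 *)

Lemma qprod_inf_neg_powerRZ_neg (q : R) (k : nat) :
  0 < q -> q < 1 -> qprod_inf q (powerRZ q (- Z.of_nat (S k)) * - q) = 0.
Proof.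
(* The argument is [- q^(-k)], so the factor with [j = k] is zero; the induction peels off the
   factors before it. *)
intros h0 h1; induction k as [|k IH]; rewrite qprod_inf_powerRZ_rec by lra.
- simpl; field_simplify_eq; lra.
- replace (- Z.of_nat (S (S k)) + 1)%Z with (- Z.of_nat (S k))%Z by lia.
  rewrite IH; ring.
Qed.

(** At [t = - q] all terms of negative index vanish, and the other half is the series of
    [qbinomial]. *)
Lemma psi_neg_q (q z a : R) :
  0 < q -> q < 1 -> 0 < z -> z < 1 -> 0 < a ->
  ex_zseries (psi_term q z a (- q)) /\
  psi q z a (- q) = qprod_inf q (- q) * qprod_inf q (z * a) /
                    (qprod_inf q a * qprod_inf q (- z)).
Proof.
intros h0 h1 hz0 hz1 ha.
destruct (qbinomial q a z h0 h1 ltac:(lra) hz0 hz1) as [he hs].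
assert (E : forall m, qprod_inf q (- q ^ S m) / qprod_inf q (q ^ m * a) * z ^ m =
  psi_term q z a (- q) (Z.of_nat m)).
{ intros m; unfold psi_term; rewrite <- !pow_powerRZ.
  replace (- q ^ S m) with (q ^ m * - q) by (simpl; ring); ring. }
(* Zero is written as [0 * 0 ^ k] so that summability comes from a geometric series. *)
assert (E0 : forall k, 0 * 0 ^ k = psi_term q z a (- q) (- Z.of_nat (S k))).
{ intros k; unfold psi_term; rewrite qprod_inf_neg_powerRZ_neg by lra.
  unfold Rdiv; ring. }
split; [split|].
- exact (ex_series_ext _ _ E he).
- apply (ex_series_ext _ _ E0), (ex_series_scal_l (K := R_AbsRing) (V := R_NormedModule)).
  apply ex_series_geom; rewrite Rabs_R0; lra.
- unfold psi, ZSeries; rewrite <- (Series_ext _ _ E), <- (Series_ext _ _ E0), hs.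
  rewrite Series_scal_l; ring.
Qed.

(** Replacing [n] by [n + 1] turns the parameters [(a / q, t)] into [(a, q * t)]. Repeated use
    carries [t = - q] to higher powers of [q]. *)
Lemma psi_shift (q z a t : R) :
  0 < q -> q < 1 -> 0 < z -> 0 < a ->
  ex_zseries (psi_term q z (a / q) t) ->
  ex_zseries (psi_term q z a (q * t)) /\
  psi q z a (q * t) = / z * psi q z (a / q) t.
Proof.
intros h0 h1 hz ha he.
assert (E : forall n,
  / z * psi_term q z (a / q) t (n + 1) = psi_term q z a (q * t) n).
{ intros n; unfold psi_term.
  rewrite !powerRZ_add, !powerRZ_1 by lra.
  replace (powerRZ q n * q * (a / q)) with (powerRZ q n * a) by (field; lra).
  replace (powerRZ q n * q * t) with (powerRZ q n * (q * t)) by ring.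
  unfold Rdiv; rewrite <- !Rmult_assoc; do 2 f_equal; field; lra. }
destruct (ZSeries_succ _ he) as [he' hs].
split.
- exact (ex_zseries_ext _ _ E (ex_zseries_scal (/ z) _ he')).
- unfold psi; rewrite <- hs, <- ZSeries_scal; symmetry; now apply ZSeries_ext.
Qed.

(** Obtained from [psi_neg_q] by [N + 1] shifts, each contributing one of the [N + 1] factors of
    [qpartial]. The induction varies [a], since a shift refers back to [a / q]. *)
Lemma psi_neg_qpow (q z a : R) (N : nat) :
  0 < q -> q < 1 -> 0 < z -> z < 1 -> 0 < a ->
  ex_zseries (psi_term q z a (- q ^ S (S N))) /\
  psi q z a (- q ^ S (S N)) =
    qprod_inf q (- q) / qprod_inf q (- z) *
    (qprod_inf q (z * a) / qprod_inf q a) *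
    (qpartial q (q / (z * a)) N / qpartial q (q / a) N).
Proof.
intros h0 h1 hz0 hz1; revert a.
assert (hP : forall x, 0 <= x -> 0 < qprod_inf q x)
  by (intros; apply qprod_inf_pos; lra).
assert (hp : forall x n, 0 <= x -> 0 < qpartial q x n)
  by (intros; apply qpartial_pos; lra).
assert (hm : 0 < qprod_inf q (- z)) by (apply qprod_inf_pos; lra).
assert (hq : forall a, 0 < a -> 0 < a / q)
  by (intros; now apply Rdiv_lt_0_compat).
(* Uses [1 + z a / q = (z a / q) (1 + q / (z a))] and its analogue without [z]; the resulting factor
   [z] cancels the [/ z] of [psi_shift]. *)
assert (hrec : forall a, 0 < a -> qprod_inf q (z * (a / q)) / qprod_inf q (a / q) =
  z * (qprod_inf q (z * a) / qprod_inf q a) * ((1 + q / (z * a)) / (1 + q / a))).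
{ intros a ha; specialize (hq a ha).
  rewrite (qprod_inf_rec q (z * (a / q))), (qprod_inf_rec q (a / q)) by lra.
  replace (q * (z * (a / q))) with (z * a) by (field; lra).
  replace (q * (a / q)) with a by (field; lra).
  pose proof (hP a ltac:(lra)).
  field; repeat split; nra. }
induction N as [|N IH]; intros a ha; specialize (hq a ha).
- destruct (psi_neg_q q z (a / q)) as [he hs]; try lra.
  destruct (psi_shift q z a (- q)) as [he' hs']; try lra; [exact he|].
  replace (- q ^ 2) with (q * - q) by ring.
  split; [exact he'|].
  rewrite hs', hs.
  pose proof (hP (a / q) ltac:(lra)); pose proof (hP a ltac:(lra)).
  transitivity (/ z * (qprod_inf q (- q) / qprod_inf q (- z)) *
    (qprod_inf q (z * (a / q)) / qprod_inf q (a / q))); [field; lra|].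
  rewrite hrec by exact ha; unfold qpartial; simpl; rewrite !Rmult_1_l.
  field; repeat split; nra.
- destruct (IH (a / q)) as [he hs]; try lra.
  destruct (psi_shift q z a (- q ^ S (S N))) as [he' hs']; try lra; [exact he|].
  replace (- q ^ S (S (S N))) with (q * - q ^ S (S N)) by (simpl; ring).
  split; [exact he'|].
  rewrite hs', hs, hrec by exact ha.
  rewrite !qpartial_shift.
  replace (q / (z * (a / q))) with (q * (q / (z * a))) by (field; lra).
  replace (q / (a / q)) with (q * (q / a)) by (field; lra).
  assert (0 < q / a) by now apply Rdiv_lt_0_compat.
  pose proof (hp (q * (q / a)) N ltac:(nra)).
  pose proof (hP a ltac:(lra)).
  field; repeat split; nra.
Qed.

Lemma psi_0 (q z a : R) :
  0 < q -> q < 1 -> 0 < z -> z < 1 -> 0 < a ->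
  psi q z a 0 =
    qprod_inf q (- q) / qprod_inf q (- z) *
    (qprod_inf q (z * a) / qprod_inf q a) *
    (qprod_inf q (q / (z * a)) / qprod_inf q (q / a)).
Proof.
intros h0 h1 hz0 hz1 ha.
assert (L1 : is_lim_seq (fun N => psi q z a (- q ^ S (S N))) (psi q z a 0)).
{ apply is_lim_psi0; auto.
  apply is_lim_seq_ext with (fun N => q ^ S (S N) * -1); [intros; ring|].
  apply (is_lim_seq_incr_1 (fun N => q ^ S N * -1)).
  apply (is_lim_seq_incr_1 (fun N => q ^ N * -1)).
  now apply is_lim_seq_pow_scal. }
apply (is_lim_seq_ext _ _ _ (fun N => proj2 (psi_neg_qpow q z a N h0 h1 hz0 hz1 ha))) in L1.
assert (hr : 0 < q / a) by now apply Rdiv_lt_0_compat.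
pose proof (qprod_inf_pos q (q / a) h0 h1 ltac:(lra)).
assert (L2 : is_lim_seq (fun N => qprod_inf q (- q) / qprod_inf q (- z) *
    (qprod_inf q (z * a) / qprod_inf q a) *
    (qpartial q (q / (z * a)) N / qpartial q (q / a) N))
  (qprod_inf q (- q) / qprod_inf q (- z) *
    (qprod_inf q (z * a) / qprod_inf q a) *
    (qprod_inf q (q / (z * a)) / qprod_inf q (q / a)))).
{ apply is_lim_seq_mult'; [apply is_lim_seq_const|].
  apply is_lim_seq_div'; [now apply is_lim_qpartial|now apply is_lim_qpartial|lra]. }
apply is_lim_seq_unique in L1, L2; rewrite L1 in L2; now injection L2.
Qed.

(** * The two Jackson integrals as q-series *)

Theorem corollary6p1 (q A alpha beta : R)
    (hq0 : 0 < q) (hq1 : q < 1) (hA : 0 < A)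
    (halpha : 0 < alpha) (hbeta : alpha + 1 < beta) :
  let f := fun x : R => Rpower x alpha / qprod q x beta in
  let g := fun x : R =>
    Rpower x alpha * qprod q (- (1 / x)) alpha / Rpower x beta in
  ex_jackson_improper q A f /\
  ex_jackson1oo q g /\
  jackson_improper q A f =
    q / (Rpower q beta * K q A alpha) * jackson1oo q g.
Proof.
intros f g.
set (a := 1 / A); set (za := Rpower q alpha); set (z := q * za).
set (b := Rpower q beta); set (w := Rpower q (beta - alpha - 1)).
assert (ha : 0 < a) by (apply Rdiv_lt_0_compat; lra).
assert (hlt1 : forall s, 0 < s -> 0 < Rpower q s < 1).
{ intros s hs; split; [apply exp_pos|].
  unfold Rpower; rewrite <- exp_0; apply exp_increasing.
  pose proof (ln_increasing q 1 hq0 hq1) as hl; rewrite ln_1 in hl; nra. }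
assert (hza : 0 < za < 1) by (apply hlt1; lra).
assert (hz : 0 < z < 1) by (unfold z; nra).
assert (hb : 0 < b < 1) by (apply hlt1; lra).
assert (hw : 0 < w < 1) by (apply hlt1; lra).
assert (hbw : b = w * z).
{ unfold b, w, z, za; rewrite <- (Rpower_1 q hq0) at 3.
  rewrite <- !Rpower_plus; f_equal; ring. }
assert (hP : forall x, -1 < x -> 0 < qprod_inf q x)
  by (intros; now apply qprod_inf_pos).
(* At [x = q^n / A] the product [x * x^alpha] equals [A^(-(alpha + 1)) z^n], and [b * a] plays the
   part of [t]. *)
assert (Ef : forall n, Rpower A (- (alpha + 1)) * psi_term q z a (b * a) n =
  jackson_improper_term q A f n).
{ intros n; unfold jackson_improper_term, f, qprod, psi_term.
  pose proof (powerRZ_lt q n hq0) as hqn.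
  replace (powerRZ q n * (b * a)) with (Rpower q beta * (powerRZ q n / A))
    by (unfold b, a; field; lra).
  replace (powerRZ q n * a) with (powerRZ q n / A) by (unfold a; field; lra).
  assert (hx : 0 < powerRZ q n / A) by now apply Rdiv_lt_0_compat.
  pose proof (hP (powerRZ q n / A) ltac:(lra)).
  pose proof (hP (Rpower q beta * (powerRZ q n / A))
    ltac:(fold b; pose proof (Rmult_lt_0_compat _ _ (proj1 hb) hx); lra)).
  assert (Hx : powerRZ q n / A * Rpower (powerRZ q n / A) alpha =
    Rpower A (- (alpha + 1)) * powerRZ z n).
  { rewrite <- (Rpower_1 (powerRZ q n / A) hx) at 1.
    rewrite <- Rpower_plus; unfold Rdiv at 1.
    rewrite <- Rpower_mult_distr by (try apply Rinv_0_lt_compat; lra).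
    rewrite powerRZ_Rpower by lra.
    rewrite powerRZ_Rpower by lra.
    rewrite Rpower_mult.
    replace z with (Rpower q (1 + alpha))
      by (unfold z, za; rewrite Rpower_plus, Rpower_1; lra).
    rewrite Rpower_mult, <- (Rpower_1 (/ A)) by (apply Rinv_0_lt_compat; lra).
    rewrite <- (Rpower_1 A hA) at 1; rewrite <- Rpower_Ropp, !Rpower_mult.
    rewrite Rmult_comm; f_equal; f_equal; ring. }
  rewrite <- Rmult_assoc, <- Hx; field; lra. }
(* By [b = w * z] this amounts to [w < 1], that is to [alpha + 1 < beta]. *)
assert (hba : Rabs (b * a) < a * z).
{ rewrite Rabs_pos_eq by nra; rewrite hbw; assert (0 < a * z) by nra; nra. }
assert (hex : ex_zseries (psi_term q z a (b * a))).
{ apply ex_psi_pos; try lra; [nra|].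
  rewrite Rabs_pos_eq in hba by nra; exact hba. }
split; [exact (ex_zseries_ext _ _ Ef (ex_zseries_scal _ _ hex))|].
destruct (qbinomial q (- z) w) as [heg hsg]; try lra.
(* The integral from 1 starts at [n = -1], so the powers are [w ^ S k]; one [w] is split off to
   match the q-binomial series with parameter [- z]. *)
assert (Eg : forall k, w * (qprod_inf q (- q ^ S k) / qprod_inf q (q ^ k * - z) * w ^ k) =
  jackson1oo_term q g k).
{ intros k; unfold jackson1oo_term, g, qprod.
  rewrite powerRZ_neg', <- pow_powerRZ.
  set (y := q ^ S k); assert (hy : 0 < y) by now apply pow_lt.
  replace (- (1 / / y)) with (- y) by (field; lra).
  replace (q ^ k * - z) with (Rpower q alpha * - y) by (unfold y, z, za; simpl; ring).
  assert (hy1 : y <= 1) by now apply pow_in_01.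
  pose proof (hP (Rpower q alpha * - y) ltac:(fold za; nra)).
  assert (Hy : / y * Rpower (/ y) alpha / Rpower (/ y) beta = w * w ^ k).
  { change (w * w ^ k) with (w ^ S k).
    rewrite <- Rpower_pow by lra.
    unfold w, y; rewrite <- (Rpower_pow (S k) q hq0), <- Rpower_Ropp.
    rewrite <- (Rpower_1 (Rpower q (- INR (S k)))) at 1 by apply exp_pos.
    unfold Rdiv; rewrite <- Rpower_Ropp, !Rpower_mult, <- !Rpower_plus.
    f_equal; ring. }
  transitivity (/ y * Rpower (/ y) alpha / Rpower (/ y) beta *
    (qprod_inf q (- y) / qprod_inf q (Rpower q alpha * - y))).
  - rewrite Hy; ring.
  - unfold Rdiv; ring. }
split.
{ refine (ex_series_ext _ _ Eg _).
  apply (ex_series_scal_l (K := R_AbsRing) (V := R_NormedModule)); exact heg. }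
unfold jackson_improper, jackson1oo.
rewrite <- (ZSeries_ext _ _ Ef), ZSeries_scal; fold (psi q z a (b * a)).
rewrite <- (Series_ext _ _ Eg), Series_scal_l, hsg.
pose proof (psi_reduce q z a (b * a) hq0 hq1 (proj1 hz) (proj2 hz) ha hba) as hr.
replace (b * a / (z * a)) with w in hr by (rewrite hbw; field; lra).
replace (b * a / a) with b in hr by (field; lra).
rewrite psi_0 in hr by lra.
replace (w * - z) with (- b) by (rewrite hbw; ring).
assert (hAa : 0 < Rpower A alpha) by apply exp_pos.
assert (hAz : 0 < A / za) by (apply Rdiv_lt_0_compat; lra).
unfold K, qprod; fold za b a.
replace (Rpower q (1 - alpha) * A) with (q * (A / za)).
2: { unfold Rminus; rewrite Rpower_plus, Rpower_1, Rpower_Ropp by lra.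
  fold za; field; lra. }
replace (Rpower A (- (alpha + 1))) with (/ (A * Rpower A alpha)).
2: { rewrite Rpower_Ropp, Rpower_plus, Rpower_1, Rmult_comm by lra; reflexivity. }
(* Splitting off first factors gives both sides the same infinite products. The factor [1 + A]
   cancels in [K], and [(1 + A / za) / (1 + za / A)], left over after the same step in [hr], equals
   [A / za]. *)
rewrite (qprod_inf_rec q (za * a)), (qprod_inf_rec q A) by lra.
replace (q * (za * a)) with (z * a) by (unfold z; ring).
replace (q / a) with (q * A) in hr by (unfold a; field; lra).
replace (q / (z * a)) with (A / za) in hr by (unfold z, a; field; lra).
rewrite (qprod_inf_rec q (A / za)) in hr by lra.
pose proof (hP (- w) ltac:(lra)) as p1.
pose proof (hP (- z) ltac:(lra)) as p2.
pose proof (hP a ltac:(lra)) as p3.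
pose proof (hP (q * A) ltac:(nra)) as p4.
pose proof (hP (z * a) ltac:(nra)) as p5.
pose proof (hP (q * (A / za)) ltac:(nra)) as p6.
(* Multiplying and dividing by the positive [qprod_inf q (- w)] exposes the left side of [hr]. *)
assert (hr' : psi q z a (b * a) = qprod_inf q (- w) * psi q z a (b * a) / qprod_inf q (- w))
  by (field; lra).
rewrite hr', hr.
replace (za * a) with (za / A) by (unfold a; field; lra).
rewrite hbw.
set (P1 := qprod_inf q (- w)) in *; set (P2 := qprod_inf q (- z)) in *.
set (P3 := qprod_inf q (- (w * z))); set (P5 := qprod_inf q (z * a)) in *.
unfold z; assert (0 < za * A) by nra.
field; repeat split; try lra; nra.
Qed.
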